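(* Let $M$ be a field, let $\sigma=(\sigma_i)_{i=1}^n$ be a family of pairwise commuting automorphisms of $M$, and let $u=(u_{i,j})_{i,j=1}^n$ be a family of elements of $M^*$ satisfying, for all $i,j,k$, $$u_{i,i}=1,\qquad u_{i,j}u_{j,i}=1,\qquad u_{i,j}u_{j,k}u_{k,i}=\sigma_k(u_{i,j})\,\sigma_i(u_{j,k})\,\sigma_j(u_{k,i}).$$ Let $$D=M((x_1;\sigma_1))((x_2;\widehat\sigma_2))\cdots((x_n;\widehat\sigma_n))$$ be the iterated Laurent series division ring, so that $x_im=\sigma_i(m)x_i$ and $x_ix_j=u_{i,j}x_jx_i$ for $m\in M$ and $1\le i,j\le n$. Suppose that at least one of the following conditions holds: (1) $\sigma_i\ne\operatorname{id}_M$ for some $i$; (2) $u_{i,j}\ne1$ for some $i\ne j$. Then $D^*$ contains no abelian maximal subgroup.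
   Context: For a division ring $R$, $R^*=R\setminus\{0\}$ is its multiplicative group. For a division ring $A$ and $\tau\in\operatorname{Aut}(A)$, $A((x;\tau))$ denotes the division ring of twisted Laurent series $\sum_{i\ge k}a_ix^i$ ($k\in\mathbb Z$, $a_i\in A$) with $xa=\tau(a)x$. In the iterated construction, for $i\ge2$, $\widehat\sigma_i$ is the automorphism of $M((x_1;\sigma_1))\cdots((x_{i-1};\widehat\sigma_{i-1}))$ that restricts to $\sigma_i$ on $M$, sends $x_j$ to $u_{i,j}x_j$ for $j<i$, and is applied to series term by term. A maximal subgroup of a group $G$ is a proper subgroup not properly contained in any proper subgroup of $G$. *)

(* Defs.v *)
From HB Require Import structures.
From mathcomp Require Import all_boot all_order all_algebra.
From mathcomp Require Import boolp classical_sets functions fsbigop.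
From mathcomp Require Import zify ring.

Set Implicit Arguments.
Unset Strict Implicit.
Unset Printing Implicit Defensive.

Import Order.TTheory GRing.Theory Num.Theory.
Local Open Scope ring_scope.

Section Subgroups.
Local Open Scope group_scope.
Variable G : groupType.

Definition proper_subgroup (H : {pred G}) : Prop :=
  group_closed H /\ exists x, x \notin H.

Definition maximal_subgroup (H : {pred G}) : Prop :=
  proper_subgroup H /\
  forall K : {pred G}, proper_subgroup K -> {subset H <= K} -> K =i H.

Definition abelian_subgroup (H : {pred G}) : Prop :=
  group_closed H /\ {in H &, forall x y, x * y = y * x}.

End Subgroups.

HB.mixin Record UnitRing_isDivisionRing R of GRing.UnitRing R := {
  neq0_unitr : forall x : R, x != 0 -> x \is a GRing.unit
}.

#[short(type="divisionRingType")]
HB.structure Definition DivisionRing :=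
  {R of UnitRing_isDivisionRing R & GRing.UnitRing R}.

Lemma field_neq0_unitr (F : fieldType) (x : F) : x != 0 -> x \is a GRing.unit.
Proof. by rewrite unitfE. Qed.

Definition field_divisionRing (F : fieldType) : divisionRingType :=
  HB.pack F (UnitRing_isDivisionRing.Build F (@field_neq0_unitr F)).

Section MulGroup.
Variable R : divisionRingType.

Record mulGroup := MulGroup { mulGroup_val : R; _ : mulGroup_val != 0 }.

HB.instance Definition _ := [isSub for mulGroup_val].
HB.instance Definition _ := [Choice of mulGroup by <:].

Lemma divring_unitE (x : R) : (x \is a GRing.unit) = (x != 0).
Proof.
apply/idP/idP; last exact: neq0_unitr.
by apply: contraTneq => ->; rewrite unitr0.
Qed.

Lemma mulGroup_unit (x : mulGroup) : val x \is a GRing.unit.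
Proof. by case: x => x xn0; rewrite divring_unitE. Qed.

Fact mulGroup_one_subproof : (1 : R) != 0. Proof. exact: oner_neq0. Qed.
Fact mulGroup_mul_subproof (x y : mulGroup) : val x * val y != 0.
Proof. by rewrite -divring_unitE unitrMl ?mulGroup_unit. Qed.
Fact mulGroup_inv_subproof (x : mulGroup) : (val x)^-1 != 0.
Proof. by rewrite -divring_unitE unitrV mulGroup_unit. Qed.

Definition mulGroup_one := MulGroup mulGroup_one_subproof.
Definition mulGroup_mul x y := MulGroup (mulGroup_mul_subproof x y).
Definition mulGroup_inv x := MulGroup (mulGroup_inv_subproof x).

Fact mulGroup_mulA : associative mulGroup_mul.
Proof. by move=> x y z; apply: val_inj; apply: mulrA. Qed.
Fact mulGroup_mul1 : left_id mulGroup_one mulGroup_mul.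
Proof. by move=> x; apply: val_inj; apply: mul1r. Qed.
Fact mulGroup_mulr1 : right_id mulGroup_one mulGroup_mul.
Proof. by move=> x; apply: val_inj; apply: mulr1. Qed.
Fact mulGroup_mulV : left_inverse mulGroup_one mulGroup_inv mulGroup_mul.
Proof. by move=> x; apply: val_inj; apply: mulVr (mulGroup_unit x). Qed.
Fact mulGroup_mulrV : right_inverse mulGroup_one mulGroup_inv mulGroup_mul.
Proof. by move=> x; apply: val_inj; apply: divrr (mulGroup_unit x). Qed.

HB.instance Definition _ := isGroup.Build mulGroup
  mulGroup_mulA mulGroup_mul1 mulGroup_mulr1 mulGroup_mulV mulGroup_mulrV.

End MulGroup.

Record ringAut (A : nzRingType) :=
  RingAut { aut_fun :> {rmorphism A -> A}; aut_bij : bijective aut_fun }.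

Section RingAutTheory.
Variables (A : nzRingType) (tau : ringAut A).

Definition aut_inv : A -> A :=
  let: exist g _ := cid (let: Bijective g gK Kg := aut_bij tau in
    ex_intro (fun h => cancel tau h /\ cancel h tau) g (conj gK Kg)) in g.

Lemma aut_invP : cancel tau aut_inv /\ cancel aut_inv tau.
Proof. by rewrite /aut_inv; case: cid. Qed.

Lemma autK : cancel tau aut_inv. Proof. by have [] := aut_invP. Qed.
Lemma aut_invK : cancel aut_inv tau. Proof. by have [] := aut_invP. Qed.
Lemma aut_inj : injective tau. Proof. exact: can_inj autK. Qed.

Definition aut_exp (i : int) : A -> A :=
  match i with
  | Posz n => iter n tau
  | Negz n => iter n.+1 aut_inv
  end.

Lemma aut_exp0 a : aut_exp 0 a = a. Proof. by []. Qed.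
Lemma aut_exp1 a : aut_exp 1 a = tau a. Proof. by []. Qed.

Lemma aut_expSr i a : aut_exp (i + 1) a = aut_exp i (tau a).
Proof.
case: i => n.
  have -> : Posz n + 1 = Posz n.+1 by lia.
  by rewrite /aut_exp iterSr.
case: n => [|n].
  have -> : Negz 0 + 1 = Posz 0 by lia.
  by rewrite /= autK.
have -> : Negz n.+1 + 1 = Negz n by lia.
by rewrite /aut_exp [RHS]iterSr autK.
Qed.

Lemma int_ind1 (P : int -> Prop) :
  P 0 -> (forall i, P i -> P (i + 1)) -> (forall i, P (i + 1) -> P i) ->
  forall i, P i.
Proof.
move=> P0 PS PP; case=> n.
  elim: n => [//|n /PS]; by have -> : Posz n + 1 = Posz n.+1 by lia.
elim: n => [|n IH]; apply: PP.
  by have -> : Negz 0 + 1 = 0 by lia.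
by have -> : Negz n.+1 + 1 = Negz n by lia.
Qed.

Lemma aut_expD i j a : aut_exp (i + j) a = aut_exp i (aut_exp j a).
Proof.
elim/int_ind1: j a => [|j IH|j IH] a; first by rewrite addr0.
  by rewrite addrA !aut_expSr IH.
by rewrite -(aut_invK a) -!aut_expSr -addrA IH.
Qed.

Lemma aut_expS i a : aut_exp (i + 1) a = tau (aut_exp i a).
Proof. by rewrite addrC aut_expD. Qed.

Fact aut_exp_is_zmod_morphism i : zmod_morphism (aut_exp i).
Proof.
elim/int_ind1: i => [|i IH|i IH] a b //; first by rewrite !aut_expS IH rmorphB.
by apply: aut_inj; rewrite rmorphB -!aut_expS IH.
Qed.

Fact aut_exp_is_monoid_morphism i : monoid_morphism (aut_exp i).
Proof.
elim/int_ind1: i => [|i [IH1 IHM]|i [IH1 IHM]] //.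
  by split=> [|a b]; rewrite !aut_expS ?IH1 ?rmorph1 // IHM rmorphM.
by split=> [|a b]; apply: aut_inj; rewrite ?rmorph1 ?rmorphM -!aut_expS.
Qed.

HB.instance Definition _ i :=
  GRing.isZmodMorphism.Build A A (aut_exp i) (aut_exp_is_zmod_morphism i).
HB.instance Definition _ i :=
  GRing.isMonoidMorphism.Build A A (aut_exp i) (aut_exp_is_monoid_morphism i).

Lemma aut_expM i a b : aut_exp i (a * b) = aut_exp i a * aut_exp i b.
Proof. exact: rmorphM. Qed.

End RingAutTheory.

(* [laurent tau] is A((x;tau)): the series [\sum_i a_i x^i] is represented by
   its coefficient function [i |-> a_i]. *)
Definition laurent_bounded (A : nzRingType) : {pred int -> A} :=
  fun f => `[< exists k : int, forall i, i < k -> f i = 0 >].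
Arguments laurent_bounded : clear implicits.

Record laurent (A : nzRingType) (tau : ringAut A) := Laurent {
  lcoef : int -> A;
  lcoef_bounded : lcoef \in laurent_bounded A
}.

HB.instance Definition _ A tau := [isSub for @lcoef A tau].
HB.instance Definition _ A (tau : ringAut A) := [Choice of laurent tau by <:].

Section LaurentZmod.
Variable A : nzRingType.

Fact laurent_bounded_zmod : zmod_closed (laurent_bounded A).
Proof.
split; first by apply/asboolP; exists 0.
move=> f g /asboolP[a fa] /asboolP[b gb]; apply/asboolP.
exists (Num.min a b) => i; rewrite lt_min => /andP[ia ib].
have -> : (f - g) i = f i - g i by [].
by rewrite fa // gb // subr0.
Qed.

HB.instance Definition _ :=
  GRing.isZmodClosed.Build (int -> A) (laurent_bounded A) laurent_bounded_zmod.

Variable tau : ringAut A.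
HB.instance Definition _ := [SubChoice_isSubZmodule of laurent tau by <:].

End LaurentZmod.

Section LaurentRing.
Variables (A : nzRingType) (tau : ringAut A).
Notation L := (laurent tau).
Implicit Types (f g h : L) (i j k m : int).

Lemma laurentP f g : (forall i, lcoef f i = lcoef g i) <-> f = g.
Proof. by split=> [fg|-> //]; apply/val_inj/funext. Qed.

Lemma lcoef_lb f : exists k, forall i, i < k -> lcoef f i = 0.
Proof. by case: f => f fP; have /asboolP := fP. Qed.

Lemma lcoef0 i : lcoef (0 : L) i = 0. Proof. by []. Qed.
Lemma lcoefD f g i : lcoef (f + g) i = lcoef f i + lcoef g i. Proof. by []. Qed.

Lemma mk_laurent_subproof (F : int -> A) :
  (exists k, forall i, i < k -> F i = 0) -> F \in laurent_bounded A.
Proof. by move=> ?; apply/asboolP. Qed.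
Definition mk_laurent F bF : L := Laurent tau (@mk_laurent_subproof F bF).

(* The monomial a x^j. *)
Fact lmono_subproof j a :
  exists k, forall i, i < k -> (if i == j then a else 0 : A) = 0.
Proof. by exists j => i ij; rewrite ifN // lt_eqF. Qed.
Definition lmono j a : L := mk_laurent (lmono_subproof j a).
Definition lconst a : L := lmono 0 a.
Definition lvar : L := lmono 1 1.

(* Since x a = tau(a) x, (a x^i) (b x^j) = a tau^i(b) x^(i+j); the sum below has
   finite support. *)
Definition lmul_coef f g m : A :=
  \sum_(i \in [set: int]) lcoef f i * aut_exp tau i (lcoef g (m - i)).

Lemma lmul_term0 f g m a b :
    (forall i, i < a -> lcoef f i = 0) -> (forall i, i < b -> lcoef g i = 0) ->
  forall i, ~~ (a <= i <= m - b) ->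
  lcoef f i * aut_exp tau i (lcoef g (m - i)) = 0.
Proof.
move=> fa gb i; case: (ltP i a) => [/fa -> | ai]; first by rewrite mul0r.
rewrite /= => ib; rewrite gb ?rmorph0 ?mulr0 //; lia.
Qed.

Fact lmul_subproof f g : exists k, forall i, i < k -> lmul_coef f g i = 0.
Proof.
have [a fa] := lcoef_lb f; have [b gb] := lcoef_lb g.
exists (a + b) => m mab; apply: fsbig1 => i _.
by apply: (lmul_term0 fa gb); lia.
Qed.
Definition lmul f g : L := mk_laurent (lmul_subproof f g).

Definition win (a b : int) : seq int :=
  [seq a + n%:Z | n <- iota 0 (absz (Num.max 0 (b - a)))].

Lemma win_uniq a b : uniq (win a b).
Proof. by rewrite map_inj_uniq ?iota_uniq // => i j; lia. Qed.

Lemma mem_win a b i : (i \in win a b) = (a <= i < b).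
Proof.
apply/mapP/idP => [[n]|iab]; first by rewrite mem_iota => nab ->; lia.
by exists (absz (i - a)); [rewrite mem_iota|]; lia.
Qed.

Lemma fsum_seq (r : seq int) (F : int -> A) :
    uniq r -> (forall i, i \notin r -> F i = 0) ->
  \sum_(i \in [set: int]) F i = \sum_(i <- r) F i.
Proof.
move=> ur F0; rewrite (fsbigE r) //; last by move=> i _; apply: F0.
by apply: eq_bigl => i; rewrite in_setT.
Qed.

Lemma lcoefM_seq f g m a b (r : seq int) :
    (forall i, i < a -> lcoef f i = 0) -> (forall i, i < b -> lcoef g i = 0) ->
    uniq r -> (forall i, a <= i <= m - b -> i \in r) ->
  lcoef (lmul f g) m =
    \sum_(i <- r) lcoef f i * aut_exp tau i (lcoef g (m - i)).
Proof.
move=> fa gb ur rP; apply: fsum_seq => // i ir.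
by apply: (lmul_term0 fa gb); apply: contra ir; apply: rP.
Qed.

Lemma lcoefM_lt f g m a b :
    (forall i, i < a -> lcoef f i = 0) -> (forall i, i < b -> lcoef g i = 0) ->
  m < a + b -> lcoef (lmul f g) m = 0.
Proof.
move=> fa gb mab; rewrite (lcoefM_seq (r := [::]) fa gb) ?big_nil //.
by move=> i; lia.
Qed.

Lemma lmulA : associative lmul.
Proof.
move=> f g h; apply/laurentP => m.
have [a fa] := lcoef_lb f; have [b gb] := lcoef_lb g.
have [c hc] := lcoef_lb h.
pose ri := win a (m - b - c + 1); pose rk := win (a + b) (m - c + 1).
rewrite (@lcoefM_seq f (lmul g h) m a (b + c) ri) ?win_uniq //; first last.
- by move=> i; rewrite mem_win; lia.
- by move=> i; apply: lcoefM_lt.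
rewrite (@lcoefM_seq (lmul f g) h m (a + b) c rk) ?win_uniq //; first last.
- by move=> i; rewrite mem_win; lia.
- by move=> i; apply: lcoefM_lt.
transitivity (\sum_(i <- ri) \sum_(k <- rk) lcoef f i *
    aut_exp tau i (lcoef g (k - i)) * aut_exp tau k (lcoef h (m - k))).
  apply: eq_big_seq => i; rewrite mem_win => iP.
  have -> : lcoef (lmul g h) (m - i) = \sum_(k <- rk)
      lcoef g (k - i) * aut_exp tau (k - i) (lcoef h (m - k)).
    rewrite /= /lmul_coef (reindex_fsbigT (fun k => k - i)) /=; last first.
      by exists (fun k => k + i) => k; lia.
    rewrite (@fsum_seq rk) ?win_uniq // => [|k].
      apply: eq_bigr => k _.
      by have -> : m - i - (k - i) = m - k by lia.
    rewrite mem_win => kP; have -> : m - i - (k - i) = m - k by lia.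
    case: (ltP (k - i) b) => [/gb -> | kb]; first by rewrite mul0r.
    by rewrite hc ?rmorph0 ?mulr0 //; lia.
  rewrite rmorph_sum mulr_sumr; apply: eq_bigr => k _.
  by rewrite rmorphM /= -aut_expD mulrA; have -> : i + (k - i) = k by lia.
rewrite exchange_big /=; apply: eq_big_seq => k; rewrite mem_win => kP.
rewrite -[lmul_coef f g k]/(lcoef (lmul f g) k).
rewrite (lcoefM_seq (r := ri) fa gb) ?win_uniq ?mulr_suml //.
by move=> i; rewrite mem_win; lia.
Qed.

Lemma lcoef_mono j a i : lcoef (lmono j a) i = if i == j then a else 0.
Proof. by []. Qed.

Lemma lcoef_mono_lt j a i : i < j -> lcoef (lmono j a) i = 0.
Proof. by move=> ij; rewrite lcoef_mono lt_eqF. Qed.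

Lemma lcoefMmono f j b m :
  lcoef (lmul f (lmono j b)) m = lcoef f (m - j) * aut_exp tau (m - j) b.
Proof.
rewrite /= /lmul_coef (@fsum_seq [:: m - j]) //; last first.
  move=> i; rewrite inE lcoef_mono => iP; rewrite ifN ?rmorph0 ?mulr0 //; lia.
by rewrite big_seq1 lcoef_mono ifT //; lia.
Qed.

Lemma lcoefmonoM j b f m :
  lcoef (lmul (lmono j b) f) m = b * aut_exp tau j (lcoef f (m - j)).
Proof.
rewrite /= /lmul_coef (@fsum_seq [:: j]) //; last first.
  by move=> i; rewrite inE lcoef_mono => /negPf ->; rewrite mul0r.
by rewrite big_seq1 lcoef_mono eqxx.
Qed.

Lemma lmul1r : left_id (lconst 1) lmul.
Proof. by move=> f; apply/laurentP=> m; rewrite lcoefmonoM mul1r subr0. Qed.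

Lemma lmulr1 : right_id (lconst 1) lmul.
Proof.
by move=> f; apply/laurentP=> m; rewrite lcoefMmono rmorph1 mulr1 subr0.
Qed.

Lemma lmulDl : left_distributive lmul +%R.
Proof.
move=> f g h; apply/laurentP => m; rewrite lcoefD.
have [a1 fa] := lcoef_lb f; have [a2 ga] := lcoef_lb g.
have [c hc] := lcoef_lb h; pose a := Num.min a1 a2.
have fa' i : i < a -> lcoef f i = 0 by move=> ia; apply: fa; lia.
have ga' i : i < a -> lcoef g i = 0 by move=> ia; apply: ga; lia.
have fga i : i < a -> lcoef (f + g) i = 0.
  by move=> ia; rewrite lcoefD fa' // ga' // addr0.
have rP i : a <= i <= m - c -> i \in win a (m - c + 1) by rewrite mem_win; lia.
rewrite (lcoefM_seq fa' hc (win_uniq _ _) rP).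
rewrite (lcoefM_seq ga' hc (win_uniq _ _) rP).
rewrite (lcoefM_seq fga hc (win_uniq _ _) rP) -big_split /=.
by apply: eq_bigr => i _; rewrite -mulrDl.
Qed.

Lemma lmulDr : right_distributive lmul +%R.
Proof.
move=> h f g; apply/laurentP => m; rewrite lcoefD.
have [a1 fa] := lcoef_lb f; have [a2 ga] := lcoef_lb g.
have [c hc] := lcoef_lb h; pose a := Num.min a1 a2.
have fa' i : i < a -> lcoef f i = 0 by move=> ia; apply: fa; lia.
have ga' i : i < a -> lcoef g i = 0 by move=> ia; apply: ga; lia.
have fga i : i < a -> lcoef (f + g) i = 0.
  by move=> ia; rewrite lcoefD fa' // ga' // addr0.
have rP i : c <= i <= m - a -> i \in win c (m - a + 1) by rewrite mem_win; lia.
rewrite (lcoefM_seq hc fa' (win_uniq _ _) rP).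
rewrite (lcoefM_seq hc ga' (win_uniq _ _) rP).
rewrite (lcoefM_seq hc fga (win_uniq _ _) rP) -big_split /=.
by apply: eq_bigr => i _; rewrite -mulrDr -rmorphD.
Qed.

Lemma lone_neq0 : lconst 1 != 0 :> L.
Proof.
by apply/eqP => /laurentP/(_ 0)/eqP; rewrite lcoef_mono eqxx lcoef0 oner_eq0.
Qed.

HB.instance Definition _ := GRing.Zmodule_isNzRing.Build L
  lmulA lmul1r lmulr1 lmulDl lmulDr lone_neq0.

Lemma laurent1E : 1 = lconst 1 :> L. Proof. by []. Qed.

Lemma lcoefM f g m : lcoef (f * g) m =
  \sum_(i \in [set: int]) lcoef f i * aut_exp tau i (lcoef g (m - i)).
Proof. by []. Qed.

Lemma lmonoM i a j b :
  lmono i a * lmono j b = lmono (i + j) (a * aut_exp tau i b).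
Proof.
apply/laurentP => m; rewrite [LHS]lcoefmonoM !lcoef_mono.
have -> : (m - i == j) = (m == i + j) by apply/idP/idP; lia.
by case: eqP; rewrite ?rmorph0 ?mulr0.
Qed.

Fact lconst_is_zmod_morphism : zmod_morphism lconst.
Proof.
move=> a b; apply/laurentP => i.
change (lcoef (lconst (a - b)) i = lcoef (lconst a) i - lcoef (lconst b) i).
by rewrite !lcoef_mono; case: eqP; rewrite ?subr0.
Qed.
Fact lconst_is_monoid_morphism : monoid_morphism lconst.
Proof. by split=> [|a b] //; rewrite lmonoM. Qed.
HB.instance Definition _ :=
  GRing.isZmodMorphism.Build A L lconst lconst_is_zmod_morphism.
HB.instance Definition _ :=
  GRing.isMonoidMorphism.Build A L lconst lconst_is_monoid_morphism.

Lemma lvar_const a : lvar * lconst a = lconst (tau a) * lvar.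
Proof. by rewrite !lmonoM add0r addr0 mul1r mulr1. Qed.

Lemma lconst_var c : lconst c * lvar = lmono 1 c.
Proof. by rewrite lmonoM add0r mulr1. Qed.

End LaurentRing.

Section LaurentDivision.
Variables (A : divisionRingType) (tau : ringAut A).
Notation L := (laurent tau).

Lemma laurent_valuation (f : L) : f != 0 ->
  exists2 a, lcoef f a != 0 & forall i, i < a -> lcoef f i = 0.
Proof.
move=> fn0; have [k fk] := lcoef_lb f.
have ex : exists n : nat, lcoef f (k + n%:Z) != 0.
  apply: contrapT => nex; move/eqP: fn0; apply; apply/laurentP => i.
  rewrite lcoef0; case: (ltP i k) => [/fk // | ki].
  apply/eqP; apply: contrapT => /negP fi; apply: nex; exists (absz (i - k)).
  by have -> : k + (absz (i - k))%:Z = i by lia.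
exists (k + (ex_minn ex)%:Z); case: ex_minnP => n fn nmin //.
move=> i ikn; case: (ltP i k) => [/fk // | ki]; apply/eqP.
apply: contraT => fi; have := nmin (absz (i - k)).
have -> : k + (absz (i - k))%:Z = i by lia.
by move=> /(_ fi); lia.
Qed.

Lemma strong_rec (T : Type) (F : nat -> (nat -> T) -> T) (x0 : T) :
    (forall n g g', (forall k, (k < n)%N -> g k = g' k) -> F n g = F n g') ->
  exists G : nat -> T, forall n, G n = F n G.
Proof.
move=> Fext.
pose P := fix P (n : nat) : nat -> T :=
  if n is n'.+1 then fun k => if (k < n')%N then P n' k else F n' (P n')
  else fun=> x0.
have PE n m k : (k < n)%N -> (n <= m)%N -> P m k = P n k.
  move=> kn; elim: m => [|m IH]; first by case: n kn.
  rewrite leq_eqVlt => /orP[/eqP <- //|]; rewrite ltnS => nm.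
  by rewrite /= (leq_trans kn nm) IH.
exists (fun n => P n.+1 n) => n; rewrite [LHS]/= ltnn.
by apply: Fext => k kn; apply: (PE k.+1 n).
Qed.

Lemma laurent_right_inverse (f : L) : f != 0 -> exists g : L, f * g = 1.
Proof.
move=> /laurent_valuation[a fa0 fa].
pose F (n : nat) (g : nat -> A) : A := aut_exp tau (- a)
  ((lcoef f a)^-1 * ((n == 0)%:R - \sum_(t < n)
    lcoef f (a + t.+1%:Z) * aut_exp tau (a + t.+1%:Z) (g (n - t.+1)%N))).
have [G GE] : exists G, forall n, G n = F n G.
  apply: (strong_rec 0) => n g g' gg'; rewrite /F.
  do 3!congr (_ _); congr (- _); apply: eq_bigr => t _.
  by rewrite gg' //; have := ltn_ord t; lia.
have gP : exists k, forall i : int, i < k ->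
    (if i < - a then 0 else G (absz (i + a))) = 0.
  by exists (- a) => i ->.
pose g : L := mk_laurent tau gP; exists g.
have ga i : i < - a -> lcoef g i = 0 by rewrite /= => ->.
have gE (n t : nat) : (t <= n)%N ->
    lcoef g (Posz n - (a + t%:Z)) = G (n - t)%N.
  move=> tn; rewrite /= ifN; last by lia.
  by congr (G _); lia.
move: g ga gE => g ga gE; clear gP.
apply/laurentP => m; rewrite laurent1E lcoef_mono.
case: (ltP m 0) => [m0|].
  rewrite ifN; last by lia.
  by apply: (lcoefM_lt fa ga); lia.
case: m => // n _.
rewrite (@lcoefM_seq _ _ _ _ _ _ _ (win a (a + n.+1%:Z)) fa ga) ?win_uniq //.
  rewrite /win; have -> : absz (Num.max 0 (a + n.+1%:Z - a)) = n.+1 by lia.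
  rewrite /= big_cons big_map addr0.
  have := gE n 0%N isT; rewrite addr0 subn0 => ->.
  rewrite {1}GE /F -aut_expD subrr aut_exp0 mulrA divrr ?neq0_unitr // mul1r.
  have -> : iota 1 n = map (addn 1) (index_iota 0 n).
    by rewrite /index_iota subn0 -iotaDl.
  rewrite big_map big_mkord.
  under [X in _ + X]eq_bigr => t _ do rewrite add1n (gE n t.+1 (ltn_ord t)).
  by rewrite subrK; case: n.
by move=> i; rewrite mem_win; lia.
Qed.

Lemma laurent_inverse (f : L) : f != 0 -> exists g : L, g * f = 1 /\ f * g = 1.
Proof.
move=> fn0; have [g fg] := laurent_right_inverse fn0; exists g; split=> //.
have gn0 : g != 0.
  by apply/eqP => g0; have /eqP := fg; rewrite g0 mulr0 eq_sym oner_eq0.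
have [h gh] := laurent_right_inverse gn0.
by rewrite -[f]mulr1 -gh [f * _]mulrA fg mul1r.
Qed.

Definition linv (f : L) : L :=
  if pselect (f != 0) is left fn0 then sval (cid (laurent_inverse fn0)) else f.

Fact linvP (f : L) : f != 0 -> linv f * f = 1 /\ f * linv f = 1.
Proof. by rewrite /linv; case: pselect => // fn0 _; case: cid. Qed.
Fact lmulV : {in [pred f : L | f != 0], left_inverse 1 linv *%R}.
Proof. by move=> f /linvP[]. Qed.
Fact lmulrV : {in [pred f : L | f != 0], right_inverse 1 linv *%R}.
Proof. by move=> f /linvP[]. Qed.
Fact lunitP (f g : L) : g * f = 1 /\ f * g = 1 -> f != 0.
Proof.
case=> gf _; apply/eqP => f0; have /eqP := gf.
by rewrite f0 mulr0 eq_sym oner_eq0.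
Qed.
Fact linv_out : {in [predC [pred f : L | f != 0]], linv =1 id}.
Proof. by move=> f; rewrite inE /linv; case: pselect => [? /negP|]. Qed.

HB.instance Definition _ :=
  GRing.NzRing_hasMulInverse.Build L lmulV lmulrV lunitP linv_out.
HB.instance Definition _ :=
  UnitRing_isDivisionRing.Build L (fun f fn0 => fn0).

End LaurentDivision.

(* The map [\sum_i a_i x^i |-> \sum_i rho(a_i) (c x)^i] of A((x;tau)), where
   (c x)^i is a monomial of degree i (lemma [lext_powE]). It is an automorphism
   as soon as it respects the relation x a = tau(a) x, that is, when
   [c * tau (rho a) = rho (tau a) * c]. *)
Section TermwiseExtension.
Variables (A : divisionRingType) (tau rho : ringAut A) (c : A).
Notation L := (laurent tau).

Definition lext_pow (i : int) : L := (lconst tau c * lvar tau) ^ i.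

Fact lext_subproof (f : L) : exists k, forall i, i < k ->
  rho (lcoef f i) * lcoef (lext_pow i) i = 0.
Proof.
by have [k fk] := lcoef_lb f; exists k => i /fk ->; rewrite rmorph0 mul0r.
Qed.
Definition lext (f : L) : L := mk_laurent tau (lext_subproof f).

Hypothesis c_neq0 : c != 0.

Lemma lext_base_unit : lconst tau c * lvar tau \is a GRing.unit.
Proof.
rewrite divring_unitE lconst_var; apply/eqP => /laurentP/(_ 1)/eqP.
by rewrite lcoef_mono eqxx (negPf c_neq0).
Qed.

Lemma lext_powS i : lext_pow (i + 1) = lext_pow i * lmono tau 1 c.
Proof. by rewrite /lext_pow exprzDr ?lext_base_unit // expr1z lconst_var. Qed.

Lemma lext_powE i : lext_pow i = lmono tau i (lcoef (lext_pow i) i).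
Proof.
suff [a ->] : exists a, lext_pow i = lmono tau i a by rewrite lcoef_mono eqxx.
elim/int_ind1: i => [|i [a IH]|i [a IH]]; first by exists 1.
  by exists (a * aut_exp tau i c); rewrite lext_powS IH lmonoM.
exists (a * (aut_exp tau i c)^-1).
have cu : aut_exp tau i c \is a GRing.unit by rewrite rmorph_unit ?neq0_unitr.
have xu : lmono tau 1 c \is a GRing.unit by rewrite -lconst_var lext_base_unit.
apply: (mulIr xu); rewrite -lext_powS IH lmonoM.
by rewrite -mulrA mulVr // mulr1.
Qed.

Definition lext_w i : A := lcoef (lext_pow i) i.

Lemma lext_w0 : lext_w 0 = 1. Proof. by []. Qed.

Lemma lext_wS i : lext_w (i + 1) = lext_w i * aut_exp tau i c.
Proof.
by rewrite /lext_w lext_powS lext_powE lmonoM lcoef_mono eqxx lcoef_mono eqxx.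
Qed.

Lemma lext_w_unit i : lext_w i \is a GRing.unit.
Proof.
have cu j : aut_exp tau j c \is a GRing.unit by rewrite rmorph_unit ?neq0_unitr.
elim/int_ind1: i => [|i IH|i]; first exact: unitr1.
  by rewrite lext_wS unitrMl.
by rewrite lext_wS unitrMl.
Qed.

Lemma lcoef_lext f i : lcoef (lext f) i = rho (lcoef f i) * lext_w i.
Proof. by []. Qed.

Hypothesis rho_tau : forall a, rho (tau a) * c = c * tau (rho a).

Lemma lext_w_comm i a :
  rho (aut_exp tau i a) * lext_w i = lext_w i * aut_exp tau i (rho a).
Proof.
have cu j : aut_exp tau j c \is a GRing.unit by rewrite rmorph_unit ?neq0_unitr.
elim/int_ind1: i a => [|i IH|i IH] a; first by rewrite lext_w0 mulr1 mul1r.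
  rewrite lext_wS aut_expSr mulrA IH -mulrA -mulrA -aut_expM rho_tau aut_expM.
  by rewrite -aut_expSr.
rewrite -(aut_invK tau a); move: (aut_inv tau a) => {}a.
apply: (mulIr (cu i)); rewrite -aut_expSr -!mulrA -lext_wS IH.
by rewrite -aut_expM rho_tau aut_expM lext_wS -aut_expSr mulrA.
Qed.

Fact lext_is_zmod_morphism : zmod_morphism lext.
Proof.
move=> f g; apply/laurentP => i.
change (lcoef (lext (f - g)) i = lcoef (lext f) i - lcoef (lext g) i).
by rewrite !lcoef_lext -mulrBl -rmorphB.
Qed.

Fact lext_is_monoid_morphism : monoid_morphism lext.
Proof.
split=> [|f g]; apply/laurentP => m.
  rewrite lcoef_lext laurent1E lcoef_mono.
  by case: eqP => [->|_]; rewrite ?rmorph1 ?rmorph0 ?mul0r ?mul1r.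
have [a fa] := lcoef_lb f; have [b gb] := lcoef_lb g.
have efa i : i < a -> lcoef (lext f) i = 0.
  by move=> ia; rewrite lcoef_lext fa // rmorph0 mul0r.
have egb i : i < b -> lcoef (lext g) i = 0.
  by move=> ib; rewrite lcoef_lext gb // rmorph0 mul0r.
have rP i : a <= i <= m - b -> i \in win a (m - b + 1) by rewrite mem_win; lia.
rewrite lcoef_lext (lcoefM_seq fa gb (win_uniq _ _) rP).
rewrite (lcoefM_seq efa egb (win_uniq _ _) rP) rmorph_sum mulr_suml.
apply: eq_bigr => i _; rewrite !lcoef_lext !rmorphM /=.
have -> : lext_w m = lext_w i * aut_exp tau i (lext_w (m - i)).
  have /(congr1 (fun f => lcoef f m)) :
      lext_pow m = lext_pow i * lext_pow (m - i).
    rewrite /lext_pow -exprzDr ?lext_base_unit //.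
    by have -> : i + (m - i) = m by lia.
  rewrite -/(lext_w m) => ->.
  rewrite (lext_powE i) (lext_powE (m - i)) lmonoM !lcoef_mono.
  have -> : i + (m - i) = m by lia.
  by rewrite !eqxx.
by rewrite !mulrA -(mulrA (rho _)) lext_w_comm !mulrA.
Qed.

HB.instance Definition _ :=
  GRing.isZmodMorphism.Build L L lext lext_is_zmod_morphism.
HB.instance Definition _ :=
  GRing.isMonoidMorphism.Build L L lext lext_is_monoid_morphism.

Fact lext_inv_subproof (f : L) : exists k, forall i, i < k ->
  aut_inv rho (lcoef f i / lext_w i) = 0.
Proof.
have [k fk] := lcoef_lb f; exists k => i /fk ->; rewrite mul0r.
by apply: (aut_inj (tau := rho)); rewrite aut_invK rmorph0.
Qed.

Fact lext_bij : bijective lext.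
Proof.
exists (fun f => mk_laurent tau (lext_inv_subproof f)) => f; apply/laurentP => i.
  rewrite [LHS]/= -[lcoef (lext_pow i) i]/(lext_w i) mulrK ?lext_w_unit //.
  exact: autK.
by rewrite lcoef_lext [lcoef _ i in LHS]/= aut_invK divrK ?lext_w_unit.
Qed.

Definition lext_aut : ringAut L := RingAut lext_bij.

Lemma lext_const a : lext_aut (lconst tau a) = lconst tau (rho a).
Proof.
apply/laurentP => i; rewrite lcoef_lext !lcoef_mono.
by case: eqP => [->|_]; rewrite ?mulr1 // rmorph0 mul0r.
Qed.

Lemma lext_var : lext_aut (lvar tau) = lconst tau c * lvar tau.
Proof.
rewrite lconst_var; apply/laurentP => i; rewrite lcoef_lext !lcoef_mono.
case: eqP => [->|_]; last by rewrite rmorph0 mul0r.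
by rewrite rmorph1 mul1r -[1]add0r lext_wS lext_w0 mul1r.
Qed.

End TermwiseExtension.

Section IteratedLaurent.
Variables (M : fieldType) (n : nat).
Variables (sigma : 'I_n -> ringAut M) (u : 'I_n -> 'I_n -> M).
Hypothesis sigmaC : forall i j m, sigma i (sigma j m) = sigma j (sigma i m).
Hypothesis u_neq0 : forall i j, u i j != 0.
Hypothesis u_inv : forall i j, u i j * u j i = 1.
Hypothesis u_cocycle : forall i j k,
  u i j * u j k * u k i =
  sigma k (u i j) * sigma i (u j k) * sigma j (u k i).

(* One of the rings M((x_1;sigma_1))...((x_s;hat sigma_s)), together with the
   extension hat sigma_k of every sigma_k (it is needed only for k > s, but the
   same formulas define it for all k). *)
Record stage := Stage {
  stage_ring : divisionRingType;
  stage_emb : {rmorphism M -> stage_ring};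
  stage_aut : 'I_n -> ringAut stage_ring;
  stage_autE : forall k m, stage_aut k (stage_emb m) = stage_emb (sigma k m);
  stage_autC : forall k l a,
    stage_aut k (stage_aut l a) * stage_emb (u k l) =
    stage_emb (u k l) * stage_aut l (stage_aut k a)
}.

Definition field_emb : M -> field_divisionRing M := fun m => m.
Fact field_emb_zmod : zmod_morphism field_emb. Proof. by []. Qed.
Fact field_emb_monoid : monoid_morphism field_emb. Proof. by []. Qed.
HB.instance Definition _ :=
  GRing.isZmodMorphism.Build M (field_divisionRing M) field_emb field_emb_zmod.
HB.instance Definition _ := GRing.isMonoidMorphism.Build M
  (field_divisionRing M) field_emb field_emb_monoid.

Fact stage0_autC (k l : 'I_n) (a : field_divisionRing M) :
  sigma k (sigma l a) * field_emb (u k l) =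
  field_emb (u k l) * sigma l (sigma k a).
Proof. by rewrite sigmaC mulrC. Qed.

Definition stage0 : stage :=
  @Stage (field_divisionRing M) field_emb
    (sigma : 'I_n -> ringAut (field_divisionRing M))
    (fun k m => erefl) stage0_autC.

Section NextStage.
Variables (S : stage) (j : 'I_n).
Notation tau := (stage_aut S j).
Notation L := (laurent tau).
Notation emb := (stage_emb S).

Definition next_emb : M -> L := lconst tau \o emb.
HB.instance Definition _ := GRing.RMorphism.on next_emb.

Fact next_emb_neq0 k : emb (u k j) != 0.
Proof. by rewrite fmorph_eq0. Qed.

Definition next_aut (k : 'I_n) : ringAut L :=
  lext_aut (next_emb_neq0 k) (@stage_autC S k j).

Fact next_autE k m : next_aut k (next_emb m) = next_emb (sigma k m).
Proof. by rewrite [LHS]lext_const stage_autE. Qed.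

Lemma emb_aut_exp i m : aut_exp tau i (emb m) = emb (aut_exp (sigma j) i m).
Proof.
elim/int_ind1: i m => [|i IH|i IH] m //.
  by rewrite !aut_expSr stage_autE IH.
by rewrite -(aut_invK (sigma j) m) -stage_autE -!aut_expSr IH.
Qed.

Lemma sigma_exp k i m :
  sigma k (aut_exp (sigma j) i m) = aut_exp (sigma j) i (sigma k m).
Proof.
elim/int_ind1: i m => [|i IH|i IH] m //.
  by rewrite !aut_expSr IH sigmaC.
by rewrite -(aut_invK (sigma j) m) -aut_expSr IH sigmaC -!aut_expSr.
Qed.

Lemma u_cocycle_lift k l :
  sigma k (u l j) * u k j * sigma j (u k l) =
  u k l * (sigma l (u k j) * u l j).
Proof.
have uu : sigma l (u j k) * sigma l (u k j) = 1.
  by rewrite -rmorphM u_inv rmorph1.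
transitivity ((sigma j (u k l) * sigma k (u l j) * sigma l (u j k)) *
              (u k j * sigma l (u k j))).
  rewrite -[LHS]mulr1 -uu; ring.
rewrite -u_cocycle -[RHS]mulr1 -(u_inv j k); ring.
Qed.

Notation w k i := (lext_w tau (emb (u k j)) i).

Lemma next_wS k i : w k (i + 1) = w k i * emb (aut_exp (sigma j) i (u k j)).
Proof. by rewrite lext_wS ?next_emb_neq0 // emb_aut_exp. Qed.

Lemma next_w_emb k : exists W : int -> M, forall i, w k i = emb (W i).
Proof.
suff wE : forall i, exists m, w k i = emb m.
  by have [W WE] := boolp.choice wE; exists W.
have un i : aut_exp (sigma j) i (u k j) != 0 by rewrite fmorph_eq0.
elim/int_ind1 => [|i [m IH]|i [m IH]]; first by exists 1; rewrite rmorph1.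
  by exists (m * aut_exp (sigma j) i (u k j)); rewrite next_wS IH rmorphM.
exists (m / aut_exp (sigma j) i (u k j)).
rewrite rmorphM fmorphV -IH next_wS mulrK //.
by rewrite neq0_unitr // fmorph_eq0.
Qed.

Lemma next_w_cocycle k l i :
  stage_aut S k (w l i) * w k i * aut_exp tau i (emb (u k l)) =
  emb (u k l) * (stage_aut S l (w k i) * w l i).
Proof.
have [K KE] := next_w_emb k; have [V VE] := next_w_emb l.
have KS e : K (e + 1) = K e * aut_exp (sigma j) e (u k j).
  by apply: (fmorph_inj emb); rewrite rmorphM -!KE next_wS.
have VS e : V (e + 1) = V e * aut_exp (sigma j) e (u l j).
  by apply: (fmorph_inj emb); rewrite rmorphM -!VE next_wS.
rewrite KE VE !stage_autE emb_aut_exp -!rmorphM /=; congr (emb _).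
have step e : sigma k (V (e + 1)) * K (e + 1) *
      aut_exp (sigma j) (e + 1) (u k l) =
    sigma k (V e) * K e * aut_exp (sigma j) e (u k l) *
      aut_exp (sigma j) e (sigma l (u k j) * u l j).
  rewrite KS VS rmorphM /= aut_expSr sigma_exp.
  transitivity (sigma k (V e) * K e * aut_exp (sigma j) e
     (sigma k (u l j) * u k j * sigma j (u k l))).
    by rewrite !aut_expM; ring.
  by rewrite u_cocycle_lift !aut_expM; ring.
have step' e : u k l * (sigma l (K (e + 1)) * V (e + 1)) =
    u k l * (sigma l (K e) * V e) *
      aut_exp (sigma j) e (sigma l (u k j) * u l j).
  by rewrite KS VS rmorphM /= sigma_exp aut_expM; ring.
elim/int_ind1: i => [|e IH|e].
- have K0 : K 0 = 1 by apply: (fmorph_inj emb); rewrite -KE rmorph1.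
  have V0 : V 0 = 1 by apply: (fmorph_inj emb); rewrite -VE rmorph1.
  by rewrite K0 V0 !rmorph1 !mul1r mulr1.
- by rewrite step step' IH.
rewrite step step'; apply: mulIf; rewrite fmorph_eq0 mulf_neq0 //.
by rewrite fmorph_eq0.
Qed.

Fact next_autC k l (f : L) :
  next_aut k (next_aut l f) * next_emb (u k l) =
  next_emb (u k l) * next_aut l (next_aut k f).
Proof.
apply/laurentP => i; rewrite [LHS]lcoefMmono [RHS]lcoefmonoM subr0 aut_exp0.
rewrite !lcoef_lext !rmorphM /= !mulrA -stage_autC -!mulrA; congr (_ * _).
by rewrite mulrA next_w_cocycle.
Qed.

Definition next_stage : stage := Stage next_autE next_autC.

Lemma next_aut_var k :
  next_aut k (lvar tau) = next_emb (u k j) * lvar tau.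
Proof. exact: lext_var. Qed.

Lemma next_aut_const k a :
  next_aut k (lconst tau a) = lconst tau (stage_aut S k a).
Proof. exact: lext_const. Qed.

End NextStage.

Definition iterated_laurent : divisionRingType :=
  stage_ring (foldl next_stage stage0 (enum 'I_n)).

End IteratedLaurent.

(* Main.v *)
Require Import Defs.
From mathcomp Require Import all_boot all_order all_algebra.
From mathcomp Require Import boolp zify.
Set Implicit Arguments.
Unset Strict Implicit.
Unset Printing Implicit Defensive.

Import GRing.Theory.
Local Open Scope ring_scope.

(** Write D = A((x;tau)), where x = x_n is the last variable, and let U be the
    group of 1-units 1 + x A[[x;tau]]: it is normal in D^* and not abelian as
    soon as D is not commutative. If H is an abelian maximal subgroup, then HU
    is either H, and then U is abelian, or D^*, and then D^*/U is a quotient of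
    the abelian group H, so that every commutator is a 1-unit. But either
    condition yields a commutator which is a constant c <> 1 of M: it is
    sigma_i(m)/m for x_i and m, and u_ij for x_i and x_j. *)

(** * Abelian maximal subgroups against normal subgroups *)

Section AbelianMaximal.
Local Open Scope group_scope.

Lemma abelian_maximal_commutator (G : groupType) (H N : {pred G}) :
    maximal_subgroup H -> abelian_subgroup H -> group_closed N ->
    (forall x y, x \in N -> x ^ y \in N) ->
    ~ {in N &, forall x y, x * y = y * x} ->
  forall x y, (y * x)^-1 * (x * y) \in N.
Proof.
move=> [[HC _] Hmax] [_ Hab] NC NJ Nnab.
have HM := group_closedM HC; have HV := group_closedV HC.
have NM := group_closedM NC; have NV := group_closedV NC.
(* [K] is the product HN, a subgroup because N is normal. *)
pose K : {pred G} := fun x => `[< exists2 h, h \in H & h^-1 * x \in N >].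
have HK : {subset H <= K}.
  by move=> h hH; apply/asboolP; exists h; rewrite // mulVg (proj1 NC).
have KC : group_closed K.
  split; first exact/HK/(proj1 HC).
  move=> x y /asboolP[h hH hx] /asboolP[k kH ky]; apply/asboolP.
  exists (h * k^-1); first exact/HM/HV.
  have -> : (h * k^-1)^-1 * (x / y) = ((h^-1 * x) / (k^-1 * y)) ^ k^-1.
    by rewrite conjgE !invgM !invgK !mulgA mulgK.
  exact/NJ/NM/NV.
(* If K missed x, maximality would give K = H, so N would lie in the abelian group H. *)
have KT x : x \in K.
  apply: contrapT => /negP xK; apply: Nnab.
  have NH : {subset N <= H}.
    move=> a aN; rewrite -(Hmax K _ HK); last by split; last exists x.
    by apply/asboolP; exists 1; rewrite ?invg1 ?mul1g // (proj1 HC).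
  by move=> a b /NH aH /NH bH; apply: Hab.
move=> x y; have /asboolP[h hH hx] := KT x; have /asboolP[k kH ky] := KT y.
rewrite -(mulVKg h x) -(mulVKg k y).
move: (h^-1 * x) (k^-1 * y) hx ky => a b aN bN.
(* Since h and k commute, they survive only as conjugators of elements of N. *)
have -> : (k * b * (h * a))^-1 * (h * a * (k * b)) =
    a^-1 * (b^-1) ^ h * a ^ k * b.
  rewrite !conjgE !invgM !mulgA; congr (_ * _ * _ * _).
  by rewrite -!mulgA (Hab _ _ (HV _ kH) hH).
by apply: (NM); [apply: (NM); [apply: (NM)|]|]; rewrite ?NJ ?NV.
Qed.

End AbelianMaximal.

(** * Order in x and 1-units of A((x;tau)) *)

Section OneUnits.
Variables (A : divisionRingType) (tau : ringAut A).
Notation L := (laurent tau).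
Implicit Types (f g p q : L) (a b : int).

Definition lorder_ge a f : Prop := forall i, (i < a)%R -> lcoef f i = 0.

Lemma lorder_ge_le a b f : (b <= a)%R -> lorder_ge a f -> lorder_ge b f.
Proof. by move=> ba fa i ib; apply: fa; lia. Qed.

Lemma lorder_geB a f g : lorder_ge a f -> lorder_ge a g -> lorder_ge a (f - g).
Proof.
move=> fa ga i ia.
by rewrite -[LHS]/(lcoef f i - lcoef g i) fa ?ga ?subr0.
Qed.

Lemma lorder_geM a b f g :
  lorder_ge a f -> lorder_ge b g -> lorder_ge (a + b) (f * g).
Proof. by move=> fa gb i iab; apply: (lcoefM_lt fa gb). Qed.

(** Only i = a contributes in degree a + b: the coefficient of f vanishes for i < a, that of g for i
    > a. *)
Lemma lcoefM_lead a b f g : lorder_ge a f -> lorder_ge b g ->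
  lcoef (f * g) (a + b) = lcoef f a * aut_exp tau a (lcoef g b).
Proof.
move=> fa gb; rewrite [LHS](lcoefM_seq (r := [:: a]) fa gb) //; last first.
  by move=> i; rewrite inE; lia.
by rewrite big_seq1; have -> : a + b - a = b by lia.
Qed.

(** If b is the valuation of f^-1, the leading coefficients multiply to a nonzero coefficient of f
    f^-1 = 1 in degree a + b, so b = - a. *)
Lemma lorder_geV a f : lcoef f a != 0 -> lorder_ge a f -> lorder_ge (- a) f^-1.
Proof.
move=> fa0 fa.
have f0 : f != 0 by apply: contraNneq fa0 => ->; rewrite lcoef0.
have fV0 : f^-1 != 0 by rewrite -divring_unitE unitrV divring_unitE.
have [b gb0 gb] := laurent_valuation fV0.
have lead0 : lcoef f a * aut_exp tau a (lcoef f^-1 b) != 0.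
  by rewrite -divring_unitE unitrMl ?rmorph_unit ?neq0_unitr.
have := lcoefM_lead fa gb; rewrite divrr ?divring_unitE // laurent1E lcoef_mono.
case: eqP => [ab _|_ lead]; first by apply: lorder_ge_le gb; lia.
by rewrite -lead eqxx in lead0.
Qed.

Definition one_unit : {pred mulGroup L} :=
  fun x => `[< lorder_ge 1 (val x - 1) >].

Lemma lcoef1D0 p : lorder_ge 1 p -> lcoef (1 + p) 0 = 1.
Proof. by move=> p1; rewrite lcoefD laurent1E lcoef_mono p1 // addr0. Qed.

(** f / g - 1 = (f - g) g^-1, where f - g has order at least 1 and g^-1 order at least 0, as g has
    constant term 1. *)
Lemma one_unit_closed : group_closed one_unit.
Proof.
split=> [|f g /asboolP f1 /asboolP g1]; apply/asboolP.
  by move=> i _; rewrite subrr lcoef0.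
have gu := mulGroup_unit g.
rewrite -[val _]/(val f / val g) -(divrr gu) -mulrBl -[1]addr0.
apply: lorder_geM.
  have -> : val f - val g = (val f - 1) - (val g - 1).
    by rewrite opprB addrA subrK.
  exact: lorder_geB.
have g0 : lcoef (val g) 0 = 1 by rewrite -(subrKC 1 (val g)) lcoef1D0.
rewrite -[0]oppr0; apply: lorder_geV; first by rewrite g0 oner_neq0.
move=> i i0; rewrite -(subrKC 1 (val g)) lcoefD g1; last by lia.
by rewrite addr0 laurent1E lcoef_mono_lt.
Qed.

(** With a the valuation of g, the orders of the factors of g^-1 (f - 1) g add up to - a + 1 + a. *)
Lemma one_unit_conj (f g : mulGroup L) :
  f \in one_unit -> (f ^ g)%g \in one_unit.
Proof.
move=> /asboolP f1; apply/asboolP.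
have gu := mulGroup_unit g.
have -> : val (f ^ g)%g - 1 = (val g)^-1 * ((val f - 1) * val g).
  rewrite -[val _]/((val g)^-1 * (val f * val g)).
  by rewrite mulrBl mul1r mulrBr mulVr.
have [a ga0 ga] := laurent_valuation (valP g).
have -> : 1 = - a + (1 + a) by lia.
by apply: lorder_geM; [apply: lorder_geV|apply: lorder_geM].
Qed.

(** If 1 + p and 1 + q commute, so do p and q; hence series of positive order commute, and every
    series is a quotient of two of them. *)
Lemma one_unit_comm :
    {in one_unit &, forall x y, (x * y)%g = (y * x)%g} ->
  forall f g, f * g = g * f.
Proof.
move=> Uab.
have Pab p q : lorder_ge 1 p -> lorder_ge 1 q -> p * q = q * p.
  have nz r : lorder_ge 1 r -> 1 + r != 0.
    move=> r1; apply/eqP => /(congr1 (fun s => lcoef s 0)).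
    by rewrite lcoef1D0 // lcoef0 => /eqP; rewrite oner_eq0.
  move=> p1 q1; have := Uab (MulGroup (nz p p1)) (MulGroup (nz q q1)).
  have inU r (r1 : lorder_ge 1 r) : MulGroup (nz r r1) \in one_unit.
    by apply/asboolP; rewrite /= addrC addKr.
  move=> /(_ (inU p p1) (inU q q1)) /(congr1 val).
  rewrite -[LHS]/((1 + p) * (1 + q)) -[RHS]/((1 + q) * (1 + p)).
  by rewrite !mulrDl !mulrDr !mulr1 !mul1r !addrA [1 + p + q]addrAC => /addrI.
move=> f g.
have [a fa] := lcoef_lb f; have [b gb] := lcoef_lb g.
(* Multiplication by t = x^N moves f, g and t itself to positive order. *)
pose N : int := (`|a| + `|b| + 1)%R.
pose t : L := lmono tau N 1.
have tN : lorder_ge N t by move=> i iN; apply: lcoef_mono_lt.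
have t1 : lorder_ge 1 t by apply: lorder_ge_le tN; lia.
have tu : t \is a GRing.unit.
  rewrite divring_unitE; apply/eqP => /(congr1 (fun s => lcoef s N)).
  by rewrite lcoef_mono eqxx lcoef0 => /eqP; rewrite oner_eq0.
have ft1 : lorder_ge 1 (f * t).
  by apply: (lorder_ge_le _ (lorder_geM fa tN)); lia.
have gt1 : lorder_ge 1 (g * t).
  by apply: (lorder_ge_le _ (lorder_geM gb tN)); lia.
have ft : f * t = t * f by apply: (mulIr tu); rewrite (Pab _ _ ft1 t1) mulrA.
have gt : g * t = t * g by apply: (mulIr tu); rewrite (Pab _ _ gt1 t1) mulrA.
(* As t commutes with f and g, both f g t t = (f t) (g t) and g f t t = (g t) (f t); these have
   factors of positive order. *)
have shift h k : k * t = t * k -> h * k * t * t = h * t * (k * t).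
  by move=> kt; rewrite -!mulrA [t * (k * t)]mulrA -kt -mulrA.
by apply: (mulIr tu); apply: (mulIr tu); rewrite !shift // Pab.
Qed.

Lemma no_abelian_maximal f g (c : A) (H : {pred mulGroup L}) :
    f != 0 -> g != 0 -> c != 1 -> f * g = lconst tau c * (g * f) ->
  maximal_subgroup H -> ~ abelian_subgroup H.
Proof.
move=> f0 g0 c1 fgE Hmax Hab.
have fu : f \is a GRing.unit by rewrite divring_unitE.
have gu : g \is a GRing.unit by rewrite divring_unitE.
have gfu : g * f \is a GRing.unit by rewrite unitrMl.
(* Otherwise f g = g f, and the constant terms in fg (gf)^-1 = c give c = 1. *)
have Unab : ~ {in one_unit &, forall x y, (x * y)%g = (y * x)%g}.
  move=> /one_unit_comm/(_ f g); rewrite fgE => /(canRL (mulrK gfu)).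
  rewrite divrr // => /(congr1 (fun s => lcoef s 0)).
  by rewrite laurent1E !lcoef_mono eqxx => /eqP; apply/negP.
have := abelian_maximal_commutator Hmax Hab one_unit_closed one_unit_conj Unab.
move=> /(_ (MulGroup f0) (MulGroup g0)).
(* The commutator obtained is (gf)^-1 (fg); conjugating by (gf)^-1 turns it into (fg) (gf)^-1 = c,
   whose difference with 1 must vanish in degree 0. *)
set F := MulGroup f0; set G := MulGroup g0 => /(one_unit_conj (G * F)^-1)%g.
move=> /asboolP/(_ 0 isT).
have -> : val (((G * F)^-1 * (F * G)) ^ (G * F)^-1)%g = lconst tau c.
  rewrite conjgE invgK mulgA mulgA mulgV mul1g.
  rewrite -[LHS]/(f * g / (g * f)) fgE.
  exact: mulrK.
rewrite -[LHS]/(lcoef (lconst tau c) 0 - lcoef (1 : L) 0).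
by rewrite laurent1E !lcoef_mono eqxx => /eqP; rewrite subr_eq0; apply/negP.
Qed.

End OneUnits.

(** * The variables of the iterated ring *)

Section Variables.
Variables (M : fieldType) (n : nat).
Variables (sigma : 'I_n -> ringAut M) (u : 'I_n -> 'I_n -> M).
Hypothesis sigmaC : forall i j m, sigma i (sigma j m) = sigma j (sigma i m).
Hypothesis u_neq0 : forall i j, u i j != 0.
Hypothesis u_diag : forall i, u i i = 1.
Hypothesis u_inv : forall i j, u i j * u j i = 1.
Hypothesis u_cocycle : forall i j k,
  u i j * u j k * u k i =
  sigma k (u i j) * sigma i (u j k) * sigma j (u k i).

Notation stage := (stage sigma u).
Notation next := (next_stage sigmaC u_neq0 u_inv u_cocycle).
Notation stages s := (foldl next (stage0 u sigmaC) s).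

(** The clause on [stage_aut] feeds the induction: a new variable x_j moves past X i by applying
    [stage_aut] at j to X i, which produces u j i. *)
Lemma stage_vars (s : seq 'I_n) :
  exists X : 'I_n -> stage_ring (stages s),
  [/\ {in s, forall i, X i != 0},
      {in s, forall i m,
        X i * stage_emb (stages s) m = stage_emb (stages s) (sigma i m) * X i},
      {in s, forall i k,
        stage_aut (stages s) k (X i) = stage_emb (stages s) (u k i) * X i}
    & {in s &, forall i j,
        X i * X j = stage_emb (stages s) (u i j) * (X j * X i)}].
Proof.
elim/last_ind: s => [|s j]; first by exists (fun=> 0).
rewrite foldl_rcons; move: (stages s) => S [X [X0 XM Xaut XX]].
set tau := stage_aut S j.
(* If j already occurs in s, the newest variable replaces the older X j. *)
pose Y i : laurent tau := if i == j then lvar tau else lconst tau (X i).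
have Xs i : i \in rcons s j -> i != j -> i \in s.
  by rewrite mem_rcons inE => /orP[->|].
have YjX i : i \in s ->
    lvar tau * lconst tau (X i) =
    lconst tau (stage_emb S (u j i)) * (lconst tau (X i) * lvar tau).
  by move=> si; rewrite lvar_const Xaut // rmorphM mulrA.
exists Y; split; rewrite /Y.
- move=> i /Xs si; case: eqP si => [_ _|_ /(_ isT)/X0 Xi0].
    apply/eqP => /(congr1 (fun f => lcoef f 1)).
    by rewrite lcoef_mono eqxx lcoef0 => /eqP; rewrite oner_eq0.
  apply/eqP => /(congr1 (fun f => lcoef f 0)).
  by rewrite lcoef_mono eqxx lcoef0; apply/eqP.
- move=> i /Xs si m; case: eqP si => [-> _|_ /(_ isT) si].
    by rewrite [LHS]lvar_const stage_autE.
  by rewrite -[LHS]rmorphM XM // rmorphM.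
- move=> i /Xs si k; case: eqP si => [-> _|_ /(_ isT) si].
    exact: next_aut_var.
  by rewrite [LHS]next_aut_const Xaut // rmorphM.
move=> i k /Xs si /Xs sk; case: eqP si => [-> _|_ /(_ isT) si];
  case: eqP sk => [-> _|_ /(_ isT) sk].
- by rewrite u_diag rmorph1 mul1r.
- exact: YjX.
(* An old X i against the new variable: [YjX] is inverted by u i j * u j i = 1. *)
- rewrite YjX // -[LHS]mul1r [RHS]mulrA; congr (_ * _).
  by rewrite -rmorphM u_inv rmorph1.
by rewrite -[LHS]rmorphM XX // !rmorphM.
Qed.

(** Splitting off the last index of s exhibits the stage as a [laurent] ring over the previous one,
    in which the image of c is a constant. *)
Lemma no_abelian_maximal_stages (s : seq 'I_n) (f g : stage_ring (stages s))
    (c : M) (H : {pred mulGroup (stage_ring (stages s))}) :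
    s != [::] -> f != 0 -> g != 0 -> c != 1 ->
    f * g = stage_emb (stages s) c * (g * f) ->
  maximal_subgroup H -> ~ abelian_subgroup H.
Proof.
case/lastP: s f g H => [//|s j]; rewrite foldl_rcons => f g H _ f0 g0 c1.
by apply: no_abelian_maximal; rewrite ?fmorph_eq1.
Qed.

End Variables.

Theorem proposition4p4 (M : fieldType) (n : nat)
    (sigma : 'I_n -> ringAut M) (u : 'I_n -> 'I_n -> M)
    (sigmaC : forall (i j : 'I_n) (m : M),
       sigma i (sigma j m) = sigma j (sigma i m))
    (u_neq0 : forall i j : 'I_n, u i j != 0)
    (u_diag : forall i : 'I_n, u i i = 1)
    (u_inv : forall i j : 'I_n, u i j * u j i = 1)
    (u_cocycle : forall i j k : 'I_n,
       u i j * u j k * u k i =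
       sigma k (u i j) * sigma i (u j k) * sigma j (u k i)) :
  (exists i : 'I_n, ~ (sigma i =1 id)) \/
  (exists i j : 'I_n, i != j /\ u i j != 1) ->
  ~ exists H : {pred mulGroup (iterated_laurent sigmaC u_neq0 u_inv u_cocycle)},
      maximal_subgroup H /\ abelian_subgroup H.
Proof.
move=> nontriv [H [Hmax Hab]].
set S := foldl (next_stage sigmaC u_neq0 u_inv u_cocycle) (stage0 u sigmaC)
  (enum 'I_n) in H Hmax Hab.
have [X [X0 XM _ XX]] :=
  stage_vars sigmaC u_neq0 u_diag u_inv u_cocycle (enum 'I_n).
have [f [g [c [f0 g0 c1 fgE]]]] : exists f g : stage_ring S, exists c : M,
    [/\ f != 0, g != 0, c != 1 & f * g = stage_emb S c * (g * f)].
  case: nontriv => [[i /existsNP[m /eqP im]]|[i [j [_ uij]]]]; last first.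
    exists (X i), (X j), (u i j); rewrite !X0 ?mem_enum //; split=> //.
    by apply: XX; rewrite mem_enum.
  have m0 : m != 0 by apply: contraNneq im => ->; rewrite rmorph0.
  exists (X i), (stage_emb S m), (sigma i m / m).
  rewrite X0 ?mem_enum // fmorph_eq0; split=> //.
    by apply: contraNneq im => /(canRL (divfK m0)); rewrite mul1r => ->.
  by rewrite XM ?mem_enum // mulrA -rmorphM divfK.
(* Either condition supplies an index, so at least one variable was adjoined. *)
have n0 : (0 < n)%N.
  by case: nontriv => [[i _]|[i _]]; apply: leq_ltn_trans (ltn_ord i).
apply: (no_abelian_maximal_stages (s := enum 'I_n) _ f0 g0 c1 fgE Hmax Hab).
by rewrite -size_eq0 size_enum_ord -lt0n.
Qed.
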